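(* Let $\mathcal{A}=\mathbb{C}[x,y]$, let $n$ be a positive integer, let $\alpha_1,\dots,\alpha_n\in\mathbb{C}$ with $\alpha_1\alpha_n\neq 0$, put $h_t=\sum_{i=1}^n\alpha_i t^{i-1}$ and assume $\gcd(h_t,h_t')=1$ in $\mathbb{C}[t]$. Let $h_{xy}=h_t(xy)$, $h=xy\,h_{xy}$, $\mathcal I=h\mathcal A$, $\pi=h\,\partial_x\wedge\partial_y$, and let $$\delta^1=h_{xy}(x\partial_x+y\partial_y),\quad \delta^2=y\partial_y-x\partial_x,\quad \omega_1=\frac{y}{2h}dx+\frac{x}{2h}dy,\quad \omega_2=\frac{dy}{2y}-\frac{dx}{2x}.$$ Then for all $a,b\in\mathcal A$ the logarithmic Koszul bracket satisfies $$[a\omega_1,b\omega_2]_{\Omega^1_{\mathcal A}(\log\mathcal I)}=\frac a2\,\delta^2(b)\,\omega_2+\frac b2\,\delta^1(a)\,\omega_1.$$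
   Context: $Der_{\mathcal A}(\log\mathcal I)=\{\delta\in Der_{\mathcal A}:\delta(h)\in h\mathcal A\}=\mathcal A\delta^1\oplus\mathcal A\delta^2$, and $\Omega^1_{\mathcal A}(\log\mathcal I)=\mathcal A\omega_1\oplus\mathcal A\omega_2$ is its dual, with $\omega_j(\delta^i)=\delta_{ij}$. $\pi$ is extended $\mathcal A$-bilinearly to logarithmic 1-forms, with $\pi(dx,dy)=h$. The logarithmic Hamiltonian map $\pi^\sharp_{\log}:\Omega^1_{\mathcal A}(\log\mathcal I)\to Der_{\mathcal A}(\log\mathcal I)$ is the $\mathcal A$-linear map with $\beta(\pi^\sharp_{\log}(\alpha))=\pi(\alpha,\beta)$; it is induced by $dx\mapsto h\partial_y$, $dy\mapsto -h\partial_x$. $\widetilde d$ is the exterior derivative on logarithmic forms, $\widetilde d f=\delta^1(f)\omega_1+\delta^2(f)\omega_2$, and $\mathcal L_\delta=\iota_\delta\circ\widetilde d+\widetilde d\circ\iota_\delta$ is the Lie derivative. The logarithmic Koszul bracket is $$[\alpha,\beta]_{\Omega^1_{\mathcal A}(\log\mathcal I)}=\mathcal L_{\pi^\sharp_{\log}(\alpha)}(\beta)-\mathcal L_{\pi^\sharp_{\log}(\beta)}(\alpha)-\widetilde d\,\pi(\alpha,\beta),\qquad \alpha,\beta\in\Omega^1_{\mathcal A}(\log\mathcal I).$$ *)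

(* Defs.v *)
From HB Require Import structures.
From mathcomp Require Import all_boot all_order all_algebra.
From mathcomp Require Import fraction.
From mathcomp Require Import ring.
From mathcomp Require Import boolp reals complex.
From mathcomp.multinomials Require Import mpoly.

Set Implicit Arguments.
Unset Strict Implicit.
Unset Printing Implicit Defensive.

Import GRing.Theory.
Local Open Scope ring_scope.

Notation "x %:F" := (@FracField.tofrac _ x) : ring_scope.

Section FractionField.
Variable A : idomainType.
Local Notation K := {fraction A}.

Lemma fracE (u : K) : u = (\n_(repr u))%:F / (\d_(repr u))%:F.
Proof.
rewrite -[LHS]reprK; set r := repr u.
have dr0 : (\d_r)%:F != 0 :> K by rewrite tofrac_eq0 denom_ratioP.
apply: (mulIf dr0); rewrite mulfVK //.
rewrite /GRing.mul /= !piE; apply/eqP; rewrite piE /FracField.mulf.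
rewrite FracField.equivfE !numden_Ratio ?oner_eq0 ?mulf_neq0 ?denom_ratioP //.
  by rewrite !mulr1 mulrC.
all: exact: oner_neq0.
Qed.

Definition regular (u : K) : Prop := exists f : A, f%:F = u.

(* The inverse of the embedding of [A] in [K] on the regular elements (and 0
   elsewhere). *)
Definition regval (u : K) : A :=
  if pselect (regular u) is left e then projT1 (cid e) else 0.

Lemma regvalK (u : K) : regular u -> (regval u)%:F = u.
Proof. by rewrite /regval; case: pselect => // e _; case: cid. Qed.

Lemma tofracK (f : A) : regval f%:F = f.
Proof.
apply/eqP; rewrite -tofrac_eq; apply/eqP; rewrite regvalK //; by exists f.
Qed.

Lemma regularF (f : A) : regular f%:F.
Proof. by exists f. Qed.

Lemma regular0 : regular 0.
Proof. by exists 0; rewrite tofrac0. Qed.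

Lemma regularD u v : regular u -> regular v -> regular (u + v).
Proof. by move=> [f <-] [g <-]; exists (f + g); rewrite tofracD. Qed.

Lemma regularN u : regular u -> regular (- u).
Proof. by move=> [f <-]; exists (- f); rewrite tofracN. Qed.

Lemma regularM u v : regular u -> regular v -> regular (u * v).
Proof. by move=> [f <-] [g <-]; exists (f * g); rewrite tofracM. Qed.

Lemma regularB u v : regular u -> regular v -> regular (u - v).
Proof. by move=> ru rv; apply: regularD => //; apply: regularN. Qed.

End FractionField.

Section RationalForms.
Variable F : fieldType.
Local Notation A := {mpoly F[2]}.
Local Notation K := {fraction A}.

Definition vec2 (T : Type) (u v : T) : 'rV[T]_2 :=
  \row_i (if i == 0 then u else v).

Lemma vec2_0 (T : Type) (u v : T) : vec2 u v 0 0 = u.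
Proof. by rewrite mxE. Qed.

Lemma vec2_1 (T : Type) (u v : T) : vec2 u v 0 1 = v.
Proof. by rewrite mxE. Qed.

Lemma vec2P (T : Type) (w w' : 'rV[T]_2) :
  w 0 0 = w' 0 0 -> w 0 1 = w' 0 1 -> w = w'.
Proof.
move=> e0 e1; apply/rowP => -[[|[|//]] i].
  by rewrite (_ : Ordinal i = 0) //; apply: val_inj.
by rewrite (_ : Ordinal i = 1) //; apply: val_inj.
Qed.

(* [Der_A] is free on the partial derivatives: the row [(f, g)] stands for the
   derivation f d/dx + g d/dy, where x = 'X_0 and y = 'X_1. *)
Definition der (delta : 'rV[A]_2) (f : A) : A :=
  delta 0 0 * f^`M(0) + delta 0 1 * f^`M(1).

Definition lie_bracket (d e : 'rV[A]_2) : 'rV[A]_2 :=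
  vec2 (der d (e 0 0) - der e (d 0 0)) (der d (e 0 1) - der e (d 0 1)).

(* Partial derivatives of rational functions, by the quotient rule. *)
Definition fracder (i : 'I_2) (u : K) : K :=
  let n := \n_(repr u) in let d := \d_(repr u) in
  (n^`M(i) * d - n * d^`M(i))%:F / (d ^+ 2)%:F.

(* The row [(P, Q)] over [K] stands for the rational 1-form P dx + Q dy, and
   [R : K] for the rational 2-form R dx /\ dy. *)
Definition pairing (w : 'rV[K]_2) (delta : 'rV[A]_2) : K :=
  w 0 0 * (delta 0 0)%:F + w 0 1 * (delta 0 1)%:F.

Definition pairing2 (R : K) (d e : 'rV[A]_2) : K :=
  R * (d 0 0 * e 0 1 - d 0 1 * e 0 0)%:F.

Definition ratd0 (f : A) : 'rV[K]_2 := vec2 (f^`M(0))%:F (f^`M(1))%:F.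

Definition ratd1 (w : 'rV[K]_2) : K := fracder 0 (w 0 1) - fracder 1 (w 0 0).

Definition ratcontract (d : 'rV[A]_2) (R : K) : 'rV[K]_2 :=
  vec2 (- (R * (d 0 1)%:F)) (R * (d 0 0)%:F).

(* The bivector field h d/dx /\ d/dy on rational 1-forms: pi(dx, dy) = h. *)
Definition ratpi (h : A) (a b : 'rV[K]_2) : K :=
  h%:F * (a 0 0 * b 0 1 - a 0 1 * b 0 0).

Lemma fracder_def (i : 'I_2) (n d : A) : d != 0 ->
  fracder i (n%:F / d%:F) = (n^`M(i) * d - n * d^`M(i))%:F / (d ^+ 2)%:F.
Proof.
move=> d0; rewrite /fracder; set u := n%:F / d%:F.
have := fracE u; set n' := \n_(repr u); set d' := \d_(repr u).
have d'0 : d' != 0 by apply: denom_ratioP.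
move=> /eqP; rewrite /u eqr_div ?tofrac_eq0 // -!tofracM tofrac_eq => /eqP e.
have := congr1 (mderiv i) e; rewrite !mderivM => e'.
apply/eqP; rewrite eqr_div ?tofrac_eq0 ?expf_neq0 // -!tofracM tofrac_eq.
apply/eqP/subr0_eq.
move: (n^`M(i)) (d^`M(i)) (n'^`M(i)) (d'^`M(i)) e' => dn dd dn' dd' e'.
have e1 : dn * d' + n * dd' - (dn' * d + n' * dd) = 0 by apply/eqP; rewrite subr_eq0 e'.
have e2 : n * d' - n' * d = 0 by apply/eqP; rewrite subr_eq0 e.
transitivity ((n * d' - n' * d) * (dd * d' + d * dd')
  - (dn * d' + n * dd' - (dn' * d + n' * dd)) * (d * d')); first by ring.
by rewrite e1 e2 !mul0r subr0.
Qed.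

Lemma fracderF i (f : A) : fracder i f%:F = (f^`M(i))%:F.
Proof.
rewrite -[f%:F]divr1 -tofrac1 fracder_def ?oner_neq0 //.
by rewrite -mpolyC1 mderivC mulr0 subr0 mpolyC1 mulr1 expr1n tofrac1 divr1.
Qed.

Lemma fracderD i (u v : K) : fracder i (u + v) = fracder i u + fracder i v.
Proof.
rewrite (fracE u) (fracE v); move: (\n__) (\d__) (denom_ratioP (repr u)).
move=> n d d0; move: (\n__) (\d__) (denom_ratioP (repr v)) => m e e0.
have de0 : d * e != 0 by rewrite mulf_neq0.
rewrite addf_div ?tofrac_eq0 // -!tofracM -tofracD !fracder_def //.
rewrite !(mderivM, mderivD) addf_div ?tofrac_eq0 ?expf_neq0 //.
apply/eqP; rewrite -!(tofracM, tofracD).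
rewrite eqr_div ?tofrac_eq0 ?mulf_neq0 ?expf_neq0 // -!tofracM tofrac_eq.
apply/eqP; move: (n^`M(i)) (d^`M(i)) (m^`M(i)) (e^`M(i)) => *; ring.
Qed.

Lemma fracderM i (u v : K) :
  fracder i (u * v) = fracder i u * v + u * fracder i v.
Proof.
rewrite (fracE u) (fracE v); move: (\n__) (\d__) (denom_ratioP (repr u)).
move=> n d d0; move: (\n__) (\d__) (denom_ratioP (repr v)) => m e e0.
have de0 : d * e != 0 by rewrite mulf_neq0.
rewrite mulf_div -!tofracM !fracder_def //.
rewrite !mulf_div addf_div ?mulf_neq0 ?tofrac_eq0 ?expf_neq0 // !mderivM.
apply/eqP; rewrite -!(tofracM, tofracD).
rewrite eqr_div ?tofrac_eq0 ?mulf_neq0 ?expf_neq0 // -!tofracM tofrac_eq.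
apply/eqP; move: (n^`M(i)) (d^`M(i)) (m^`M(i)) (e^`M(i)) => *; ring.
Qed.

Lemma derM d (f g : A) : der d (f * g) = der d f * g + f * der d g.
Proof. by rewrite /der !mderivM; ring. Qed.

Lemma derD d (f g : A) : der d (f + g) = der d f + der d g.
Proof. by rewrite /der !mderivD; ring. Qed.

Lemma der_bracket d e (f : A) :
  der (lie_bracket d e) f = der d (der e f) - der e (der d f).
Proof.
rewrite {1}/der /lie_bracket vec2_0 vec2_1 [der e f]/der [der d f]/der.
rewrite !derD !derM /der (mderiv_comm 1 0 f).
move: (f^`M(0)) (f^`M(1)) => *.
ring.
Qed.

Lemma pairing_d0 f d : pairing (ratd0 f) d = (der d f)%:F.
Proof.
by rewrite /pairing vec2_0 vec2_1 /der tofracD !tofracM mulrC [X in _ + X]mulrC.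
Qed.

Lemma pairing_contract d e R : pairing (ratcontract d R) e = pairing2 R d e.
Proof.
rewrite /pairing /pairing2 vec2_0 vec2_1 tofracB !tofracM.
by rewrite mulrBr !mulrA mulNr addrC.
Qed.

Lemma pairing2_d1 w d e (f g : A) :
  pairing w d = f%:F -> pairing w e = g%:F ->
  pairing2 (ratd1 w) d e =
    (der d g)%:F - (der e f)%:F - pairing w (lie_bracket d e).
Proof.
move=> ef eg.
have Ef i := congr1 (fracder i) ef; have Eg i := congr1 (fracder i) eg.
rewrite /der !tofracD !tofracM -!fracderF -ef -eg.
rewrite /pairing /pairing2 /ratd1 /lie_bracket !vec2_0 !vec2_1 /der.
rewrite !fracderD !fracderM !fracderF !tofracB !tofracD !tofracM.
move: (fracder _ _) (fracder _ _) (fracder _ _) (fracder _ _) => a1 a2 a3 a4.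
move: (w 0 0) (w 0 1) (_ %:F) (_ %:F) (_ %:F) (_ %:F)  => *.
ring.
Qed.

End RationalForms.

Section LogForms.
Variables (F : fieldType) (h : {mpoly F[2]}).
Local Notation A := {mpoly F[2]}.
Local Notation K := {fraction A}.

(* Der_A(log hA) *)
Definition derlog_pred : {pred 'rV[A]_2} :=
  fun d => `[< exists g, der d h = h * g >].

Lemma derlogP d : reflect (exists g, der d h = h * g) (d \in derlog_pred).
Proof. exact: asboolP. Qed.

Lemma derlog_submod_closed : submod_closed derlog_pred.
Proof.
split; first by apply/derlogP; exists 0; rewrite /der !mxE !mul0r addr0 mulr0.
move=> a d e /derlogP[f ef] /derlogP[g eg]; apply/derlogP; exists (a * f + g).
by rewrite mulrDr mulrCA -ef -eg /der !mxE; ring.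
Qed.

HB.instance Definition _ :=
  GRing.isSubmodClosed.Build A 'rV[A]_2 derlog_pred derlog_submod_closed.

Record derlog := DerLog {
  derlog_val :> 'rV[A]_2;
  derlog_valP : derlog_val \in derlog_pred }.

HB.instance Definition _ := [isSub for derlog_val].
HB.instance Definition _ := [Choice of derlog by <:].
HB.instance Definition _ := [SubChoice_isSubLmodule of derlog by <:].

Lemma lie_bracket_log d e : d \in derlog_pred -> e \in derlog_pred ->
  lie_bracket d e \in derlog_pred.
Proof.
move=> /derlogP[f ef] /derlogP[g eg]; apply/derlogP.
exists (der d g - der e f).
by rewrite der_bracket ef eg !derM ef eg; ring.
Qed.

Definition form1log_pred : {pred 'rV[K]_2} :=
  fun w => `[< forall d, d \in derlog_pred -> regular (pairing w d) >].

Lemma form1logP w :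
  reflect (forall d, d \in derlog_pred -> regular (pairing w d))
          (w \in form1log_pred).
Proof. exact: asboolP. Qed.

Lemma pairing0 d : pairing (0 : 'rV[K]_2) d = 0.
Proof. by rewrite /pairing !mxE !mul0r addr0. Qed.

Lemma pairingB (v w : 'rV[K]_2) d :
  pairing (v - w) d = pairing v d - pairing w d.
Proof. by rewrite /pairing !mxE; ring. Qed.

Lemma pairingZ c (w : 'rV[K]_2) d : pairing (c *: w) d = c * pairing w d.
Proof. by rewrite /pairing !mxE mulrDr !mulrA. Qed.

Lemma form1log_zmod_closed : zmod_closed form1log_pred.
Proof.
split; first by apply/form1logP => d _; rewrite pairing0; apply: regular0.
move=> v w /form1logP Hv /form1logP Hw; apply/form1logP => d dP.
by rewrite pairingB; apply: regularB; auto.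
Qed.

HB.instance Definition _ :=
  GRing.isZmodClosed.Build 'rV[K]_2 form1log_pred form1log_zmod_closed.

(* Omega^1_A(log hA): the rational 1-forms that take values in [A] on
   Der_A(log hA); since K Der_A(log hA) = K Der_A, this is the dual of
   Der_A(log hA) when h != 0. *)
Record form1log := Form1Log {
  form1log_val :> 'rV[K]_2;
  form1log_valP : form1log_val \in form1log_pred }.

HB.instance Definition _ := [isSub for form1log_val].
HB.instance Definition _ := [Choice of form1log by <:].
HB.instance Definition _ := [SubChoice_isSubZmodule of form1log by <:].

Lemma form1log_scale_subproof (a : A) (w : form1log) :
  a%:F *: val w \in form1log_pred.
Proof.
apply/form1logP => d dP; rewrite pairingZ; apply: regularM; first exact: regularF.
by have /form1logP := form1log_valP w; apply.
Qed.

Definition form1log_scale (a : A) (w : form1log) : form1log :=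
  Form1Log (form1log_scale_subproof a w).

Fact form1log_scaleA a b w :
  form1log_scale a (form1log_scale b w) = form1log_scale (a * b) w.
Proof. by apply: val_inj; rewrite /= scalerA tofracM. Qed.

Fact form1log_scale1 : left_id 1 form1log_scale.
Proof. by move=> w; apply: val_inj; rewrite /= tofrac1 scale1r. Qed.

Fact form1log_scaleDr : right_distributive form1log_scale +%R.
Proof. by move=> a v w; apply: val_inj; rewrite /= scalerDr. Qed.

Fact form1log_scaleDl w : {morph form1log_scale^~ w : a b / a + b}.
Proof. by move=> a b; apply: val_inj; rewrite /= tofracD scalerDl. Qed.

HB.instance Definition _ := GRing.Zmodule_isLmodule.Build A form1log
  form1log_scaleA form1log_scale1 form1log_scaleDr form1log_scaleDl.

Definition form2log_pred : {pred K} :=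
  fun R => `[< forall d e, d \in derlog_pred -> e \in derlog_pred ->
                 regular (pairing2 R d e) >].

Lemma form2logP R :
  reflect (forall d e, d \in derlog_pred -> e \in derlog_pred ->
             regular (pairing2 R d e)) (R \in form2log_pred).
Proof. exact: asboolP. Qed.

(* Omega^2_A(log hA) *)
Record form2log := Form2Log {
  form2log_val :> K;
  form2log_valP : form2log_val \in form2log_pred }.

Definition contract1 (d : derlog) (w : form1log) : A := regval (pairing w d).

Lemma contract1E d w : (contract1 d w)%:F = pairing w d.
Proof.
apply: regvalK; have /form1logP := form1log_valP w; apply.
exact: derlog_valP.
Qed.

Lemma dlog0_subproof f : ratd0 f \in form1log_pred.
Proof. by apply/form1logP => d _; rewrite pairing_d0; apply: regularF. Qed.

Definition dlog0 (f : A) : form1log := Form1Log (dlog0_subproof f).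

Lemma dlog1_subproof (w : form1log) : ratd1 w \in form2log_pred.
Proof.
have /form1logP Hw := form1log_valP w.
apply/form2logP => d e dP eP.
have [f /esym ef] := Hw _ dP; have [g /esym eg] := Hw _ eP.
rewrite (pairing2_d1 ef eg); do 2?apply: regularB; try exact: regularF.
by apply: Hw; apply: lie_bracket_log.
Qed.

Definition dlog1 (w : form1log) : form2log := Form2Log (dlog1_subproof w).

Lemma contract2_subproof (d : derlog) (R : form2log) :
  ratcontract d R \in form1log_pred.
Proof.
apply/form1logP => e eP; rewrite pairing_contract.
by have /form2logP := form2log_valP R; apply => //; apply: derlog_valP.
Qed.

Definition contract2 (d : derlog) (R : form2log) : form1log :=
  Form1Log (contract2_subproof d R).

Definition lie_derivative (d : derlog) (w : form1log) : form1log :=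
  contract2 d (dlog1 w) + dlog0 (contract1 d w).

Lemma vec2_hx_log : vec2 h 0 \in derlog_pred.
Proof.
by apply/derlogP; exists (h^`M(0)); rewrite /der vec2_0 vec2_1 mul0r addr0.
Qed.

Lemma vec2_hy_log : vec2 0 h \in derlog_pred.
Proof.
by apply/derlogP; exists (h^`M(1)); rewrite /der vec2_0 vec2_1 mul0r add0r.
Qed.

Lemma vec2_ham_log : vec2 h^`M(1) (- h^`M(0)) \in derlog_pred.
Proof.
by apply/derlogP; exists 0; rewrite /der vec2_0 vec2_1; ring.
Qed.

Lemma form1log_coef (w : form1log) :
  [/\ regular (h%:F * w 0 0), regular (h%:F * w 0 1) &
      exists g, regval (h%:F * w 0 0) * h^`M(1) -
                regval (h%:F * w 0 1) * h^`M(0) = h * g].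
Proof.
have /form1logP Hw := form1log_valP w.
have r0 : regular (h%:F * w 0 0).
  have := Hw _ vec2_hx_log.
  by rewrite /pairing vec2_0 vec2_1 tofrac0 mulr0 addr0 mulrC.
have r1 : regular (h%:F * w 0 1).
  have := Hw _ vec2_hy_log.
  by rewrite /pairing vec2_0 vec2_1 tofrac0 mulr0 add0r mulrC.
split=> //; have [g] := Hw _ vec2_ham_log.
rewrite /pairing vec2_0 vec2_1 tofracN => eg; exists g.
apply/eqP; rewrite -tofrac_eq tofracB !tofracM !regvalK // eg; apply/eqP.
ring.
Qed.

(* The image of P dx + Q dy under dx |-> h d/dy, dy |-> - h d/dx. *)
Definition ham_vec (w : form1log) : 'rV[A]_2 :=
  vec2 (- regval (h%:F * w 0 1)) (regval (h%:F * w 0 0)).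

Lemma ham_subproof (w : form1log) : ham_vec w \in derlog_pred.
Proof.
have [_ _ [g eg]] := form1log_coef w; apply/derlogP; exists g.
by rewrite -eg /ham_vec /der vec2_0 vec2_1 mulNr addrC.
Qed.

Definition ham (w : form1log) : derlog := DerLog (ham_subproof w).

Lemma pairing_ham (v w : form1log) : pairing w (ham v) = ratpi h v w.
Proof.
have [r0 r1 _] := form1log_coef v.
rewrite /ham /= /ham_vec /pairing vec2_0 vec2_1 tofracN !regvalK // /ratpi.
ring.
Qed.

(* The extension of [pi] to logarithmic forms, with values in [A]. *)
Definition pilog (v w : form1log) : A := regval (ratpi h v w).

Lemma contract1_ham (v w : form1log) : contract1 (ham v) w = pilog v w.
Proof. by rewrite /contract1 pairing_ham. Qed.

Lemma pilogE (v w : form1log) : (pilog v w)%:F = ratpi h v w.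
Proof. by rewrite -contract1_ham contract1E pairing_ham. Qed.

Definition koszul (v w : form1log) : form1log :=
  lie_derivative (ham v) w - lie_derivative (ham w) v - dlog0 (pilog v w).

End LogForms.

Section Arrangement.
Variables (F : fieldType) (n : nat) (alpha : nat -> F).
Local Notation A := {mpoly F[2]}.
Local Notation K := {fraction A}.
Local Notation x := ('X_(0 : 'I_2) : A).
Local Notation y := ('X_(1 : 'I_2) : A).

Definition subst_xy (p : {poly F}) : A := (map_poly (@mpolyC 2 F) p).[x * y].

Definition ht : {poly F} := \sum_(1 <= i < n.+1) alpha i *: 'X^(i.-1).

Definition hxy : A := subst_xy ht.

Definition hdiv : A := x * y * hxy.

Definition delta1_vec : 'rV[A]_2 := hxy *: vec2 x y.

Definition delta2_vec : 'rV[A]_2 := vec2 (- x) y.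

Definition omega1_vec : 'rV[K]_2 :=
  vec2 (y%:F / (2 * hdiv%:F)) (x%:F / (2 * hdiv%:F)).

Definition omega2_vec : 'rV[K]_2 :=
  vec2 (- (1 / (2 * x%:F))) (1 / (2 * y%:F)).

Lemma subst_xyD p q : subst_xy (p + q) = subst_xy p + subst_xy q.
Proof. by rewrite /subst_xy rmorphD hornerD. Qed.

Lemma subst_xyM p q : subst_xy (p * q) = subst_xy p * subst_xy q.
Proof. by rewrite /subst_xy rmorphM hornerM. Qed.

Lemma subst_xyC c : subst_xy c%:P = c%:MP.
Proof. by rewrite /subst_xy map_polyC hornerC. Qed.

Lemma subst_xyX : subst_xy 'X = x * y.
Proof. by rewrite /subst_xy map_polyX hornerX. Qed.

Lemma derC d c : der d (c%:MP : A) = 0.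
Proof. by rewrite /der !mderivC !mulr0 addr0. Qed.

Lemma der_subst_xy d p : der d (subst_xy p) = subst_xy p^`() * der d (x * y).
Proof.
elim/poly_ind: p => [|p c ih].
  by rewrite deriv0 /subst_xy rmorph0 horner0 mul0r /der !mderiv0 !mulr0 addr0.
rewrite derivD derivM derivX derivC addr0 mulr1 !(subst_xyD, subst_xyM, subst_xyC, subst_xyX).
by rewrite derD derM derC ih; ring.
Qed.

Lemma mderivXU (i j : 'I_2) : ('X_j : A)^`M(i) = (i == j)%:R.
Proof.
rewrite mderivX mnm1E eq_sym; case: eqVneq => [->|_]; last by rewrite scale0r.
by rewrite scale1r (_ : (_ - _)%MM = 0%MM) ?mpolyX0 //; apply/mnmP => k; rewrite mnmBE mnm0E subnn.
Qed.

Lemma mpolyXU_neq0 (i : 'I_2) : 'X_i != 0 :> A.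
Proof.
apply/eqP => /(congr1 (mderiv i)) /eqP.
by rewrite mderivXU eqxx mderiv0 oner_eq0.
Qed.

Lemma der_x d : der d x = d 0 0.
Proof. by rewrite /der !mderivXU eqxx mulr1 mulr0 addr0. Qed.

Lemma der_y d : der d y = d 0 1.
Proof. by rewrite /der !mderivXU eqxx mulr1 mulr0 add0r. Qed.

Lemma der_xy d : der d (x * y) = y * d 0 0 + x * d 0 1.
Proof. by rewrite derM der_x der_y; ring. Qed.

Lemma hdivE : hdiv = subst_xy ('X * ht).
Proof. by rewrite subst_xyM subst_xyX. Qed.

Lemma divX (i j : 'I_2) (f g : A) : i != j -> f * 'X_j = g * 'X_i ->
  exists c, f = c * 'X_i.
Proof.
move=> ij e; exists (\sum_(m <- msupp f) f@_m *: 'X_[m - U_(i)]).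
rewrite {1}[f]mpolyE mulr_suml; apply: eq_big_seq => m mf.
rewrite -scalerAl -mpolyXD submK //.
apply/mnm_lepP => k; rewrite mnm1E; case: eqVneq => // <-{k}.
have : (U_(j) + m)%MM \in msupp (f * 'X_j).
  by rewrite (perm_mem (msuppMX _ _)) map_f.
rewrite e (perm_mem (msuppMX _ _)) => /mapP[k _ /mnmP/(_ i)].
by rewrite !mnmDE !mnm1E eqxx eq_sym (negbTE ij) add0n add1n => ->.
Qed.

Lemma ht_coef0 : (0 < n)%N -> ht`_0 = alpha 1.
Proof.
move=> n0; rewrite /ht big_add1 /= -(prednK n0) big_nat_recl //= coefD coefZ coefXn.
rewrite mulr1 coef_sum big1 ?addr0 // => i _.
by rewrite coefZ coefXn mulr0.
Qed.

Section Hypotheses.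
Hypothesis alpha_neq0 : alpha 1 * alpha n != 0.
Hypothesis ht_sep : coprimep ht ht^`().

Lemma n_gt0_subproof : (0 < n)%N.
Proof.
rewrite lt0n; apply/eqP => n0; move: ht_sep; rewrite /ht n0 big_geq //.
by rewrite deriv0 coprimep0 -size_poly_eq1 size_poly0.
Qed.

Lemma ht_bezout_subproof :
  exists u v, u * ('X * ht) + v * ('X * ht)^`() = 1.
Proof.
have a0 : ht.[0] != 0.
  rewrite horner_coef0 ht_coef0 ?n_gt0_subproof //.
  by move: alpha_neq0; rewrite mulf_eq0 => /norP[].
have c : coprimep ('X * ht) ('X * ht)^`().
  rewrite derivM derivX mul1r coprimepMl; apply/andP; split.
    rewrite addrC ['X * _]mulrC coprimep_addl_mul.
    by rewrite coprimep_sym -['X]subr0 -polyC0 coprimep_XsubC /root.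
  rewrite -[X in coprimep _ (X + _)]mul1r coprimep_addl_mul coprimepMr ht_sep.
  by rewrite -['X]subr0 -polyC0 coprimep_XsubC /root a0.
case/Bezout_eq1_coprimepP: c => -[u v] /= <-.
by exists u, v.
Qed.

Lemma der_xy_log d : d \in derlog_pred hdiv -> exists c, der d (x * y) = hdiv * c.
Proof.
move=> /derlogP[g]; rewrite hdivE der_subst_xy => eg.
have [u [v /(congr1 subst_xy)]] := ht_bezout_subproof.
rewrite subst_xyD (subst_xyM u) (subst_xyM v) -[1 in RHS]/(1%:P) subst_xyC mpolyC1 => e.
exists (subst_xy u * der d (x * y) + subst_xy v * g).
rewrite -[LHS]mul1r -e mulrDl -[X in _ + X]mulrA eg.
by move: (subst_xy ('X * ht)) (subst_xy u) (subst_xy v) (der d _) => *; ring.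
Qed.

Lemma delta1_log : delta1_vec \in derlog_pred hdiv.
Proof.
apply/derlogP; exists (2 * subst_xy ('X * ht)^`()).
by rewrite hdivE der_subst_xy der_xy !mxE /= subst_xyM subst_xyX /hxy; ring.
Qed.

Lemma delta2_log : delta2_vec \in derlog_pred hdiv.
Proof.
by apply/derlogP; exists 0; rewrite hdivE der_subst_xy der_xy !mxE /=; ring.
Qed.

Lemma two_subproof : 2 = ((2 : F)%:MP : A)%:F :> K.
Proof. by rewrite !rmorph_nat. Qed.

Lemma half_subproof : ((2^-1 : F)%:MP : A)%:F = 2^-1 :> K.
Proof.
have e := two_subproof.
have [z|nz] := eqVneq (2 : F) 0.
  by rewrite e z invr0 mpolyC0 tofrac0 invr0.
by apply: (mulIf (_ : (2 : K) != 0)); rewrite ?mulVf // e ?tofrac_eq0 ?mpolyC_eq0 //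
  -tofracM -mpolyCM mulVf // mpolyC1 tofrac1.
Qed.

Lemma mulr_div_cancel_subproof (t H C : K) :
  H != 0 -> H * C / (t * H) = t^-1 * C.
Proof.
by move=> H0; rewrite [t * H]mulrC invfM mulrACA divff // mul1r mulrC.
Qed.

Lemma omega1_log : omega1_vec \in form1log_pred hdiv.
Proof.
apply/form1logP => d /der_xy_log[c]; rewrite der_xy => e.
rewrite /pairing vec2_0 vec2_1.
rewrite mulrAC [X in _ + X]mulrAC -mulrDl -!tofracM -tofracD e.
have [->|h0] := eqVneq hdiv 0; first by rewrite mul0r tofrac0 mul0r; apply: regular0.
have hF : hdiv%:F != 0 by rewrite tofrac_eq0.
exists (2^-1 *: c); rewrite -mul_mpolyC tofracM [(hdiv * c)%:F]tofracM half_subproof.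
by rewrite mulr_div_cancel_subproof.
Qed.

Lemma mul_half_inv_subproof (t H C : K) :
  H != 0 -> 1 / (t * H) * (C * H) = t^-1 * C.
Proof.
by move=> H0; rewrite mul1r [C * H]mulrC [LHS]mulrC mulr_div_cancel_subproof.
Qed.

Lemma omega2_log : omega2_vec \in form1log_pred hdiv.
Proof.
apply/form1logP => d /der_xy_log[c]; rewrite der_xy /hdiv => e.
have [f ef] : exists f, d 0 0 = f * x.
  apply: (@divX 0 1 _ (y * hxy * c - d 0 1)) => //.
  by apply: (addIr (x * d 0 1)); rewrite [_ * y]mulrC {}e; ring.
have [g eg] : exists g, d 0 1 = g * y.
  apply: (@divX 1 0 _ (x * hxy * c - d 0 0)) => //.
  by apply: (addrI (y * d 0 0)); rewrite [_ * x]mulrC e; ring.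
rewrite /pairing vec2_0 vec2_1 ef eg [(f * x)%:F]tofracM [(g * y)%:F]tofracM.
have xF : x%:F != 0 by rewrite tofrac_eq0 mpolyXU_neq0.
have yF : y%:F != 0 by rewrite tofrac_eq0 mpolyXU_neq0.
rewrite mulNr (mul_half_inv_subproof 2 f%:F xF) (mul_half_inv_subproof 2 g%:F yF).
rewrite -half_subproof.
exists (2^-1%:MP * g - 2^-1%:MP * f).
by rewrite tofracB [(_ * g)%:F]tofracM [(_ * f)%:F]tofracM addrC.
Qed.

Definition delta1 : derlog hdiv := DerLog delta1_log.

Definition delta2 : derlog hdiv := DerLog delta2_log.

Definition omega1 : form1log hdiv := Form1Log omega1_log.

Definition omega2 : form1log hdiv := Form1Log omega2_log.

Lemma hxy_neq0 : hxy != 0.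
Proof.
apply/eqP => h0.
have := congr1 (mcoeff 0%MM) h0; rewrite /hxy.
have -> p : (subst_xy p)@_0 = p.[0].
  elim/poly_ind: p => [|p c ih]; first by rewrite /subst_xy rmorph0 !horner0 mcoeff0.
  rewrite subst_xyD subst_xyM subst_xyC subst_xyX mulrCA mulrC mcoeffD mcoeffC eqxx mulr1.
  rewrite hornerD hornerM hornerX hornerC mulr0; congr (_ + c).
  apply/eqP; rewrite mcoeff_eq0 (perm_mem (msuppMX _ _)).
  apply/mapP => -[m _ /mnmP/(_ 0)].
  by rewrite mnm0E mnmDE mnm1E eqxx.
rewrite horner_coef0 ht_coef0 ?n_gt0_subproof // mcoeff0 => a0.
by move: alpha_neq0; rewrite a0 mul0r eqxx.
Qed.

Lemma field_dlog0_subproof (L : fieldType) (X Y H fx fy : L) :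
  2 != 0 :> L -> X != 0 -> Y != 0 -> H != 0 ->
  fx = H * (X * fx + Y * fy) * (Y / (2 * (X * Y * H))) +
       (- X * fx + Y * fy) * (- (1 / (2 * X))) /\
  fy = H * (X * fx + Y * fy) * (X / (2 * (X * Y * H))) +
       (- X * fx + Y * fy) * (1 / (2 * Y)).
Proof. by move=> t X0 Y0 H0; split; field; rewrite t X0 Y0 H0. Qed.

Lemma dlog0E (f : A) : 2 != 0 :> F ->
  dlog0 hdiv f = der delta1 f *: omega1 + der delta2 f *: omega2.
Proof.
move=> two; have twoF : 2 != 0 :> K.
  by rewrite two_subproof tofrac_eq0 mpolyC_eq0.
have xF : x%:F != 0 by rewrite tofrac_eq0 mpolyXU_neq0.
have yF : y%:F != 0 by rewrite tofrac_eq0 mpolyXU_neq0.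
have hF : hxy%:F != 0 by rewrite tofrac_eq0 hxy_neq0.
have [e0 e1] := field_dlog0_subproof (f^`M(0))%:F (f^`M(1))%:F twoF xF yF hF.
have d1 : (der delta1 f)%:F = hxy%:F *
    (x%:F * (f^`M(0))%:F + y%:F * (f^`M(1))%:F).
  by rewrite /der /= !mxE /= -!tofracM -tofracD -tofracM; congr tofrac; ring.
have d2 : (der delta2 f)%:F = - x%:F * (f^`M(0))%:F + y%:F * (f^`M(1))%:F.
  by rewrite /der /= !mxE /= -tofracN -!tofracM -tofracD.
have eh : hdiv%:F = x%:F * y%:F * hxy%:F by rewrite /hdiv -!tofracM.
apply: val_inj; apply: vec2P.
  by rewrite /= !mxE /= d1 d2 eh -e0.
by rewrite /= !mxE /= d1 d2 eh -e1.
Qed.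

End Hypotheses.

End Arrangement.

(* Main.v *)
(** The coefficients of [koszul] are rational functions, on which the partial
    derivatives act by the Leibniz rule; hence the bracket is a derivation over
    the anchor [ham] in each argument.  Both [omega1] = d(xy) / 2h and [omega2]
    are closed, with pi(omega1, omega2) = 1/2, so that their bracket
    d pi(omega1, omega2) vanishes, and only the anchor terms remain, where
    [ham] sends [omega1] to [delta2 / 2] and [omega2] to [- delta1 / 2]. *)
Require Import Defs.
From mathcomp Require Import all_boot all_order all_algebra.
From mathcomp Require Import fraction ring.
From mathcomp Require Import reals complex.
From mathcomp.multinomials Require Import mpoly.

Import GRing.Theory.
Local Open Scope ring_scope.

(** * The Koszul bracket of an arbitrary polynomial [h] and its Leibniz rule *)

Section LogarithmicKoszul.
Context {F : fieldType} {h : {mpoly F[2]}}.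
Local Notation A := {mpoly F[2]}.
Local Notation K := {fraction A}.
Implicit Types (a b : A) (v w : form1log h).

Lemma ratd1Z a (w : 'rV[K]_2) :
  ratd1 (a%:F *: w) =
  (a^`M(0))%:F * w 0 1 - (a^`M(1))%:F * w 0 0 + a%:F * ratd1 w.
Proof.
rewrite /ratd1 !mxE !fracderM !fracderF.
by move: (fracder 0 _) (fracder 1 _) => p q; ring.
Qed.

Lemma ham0E w : (ham w 0 0)%:F = - (h%:F * w 0 1).
Proof.
have [_ r1 _] := form1log_coef w.
by rewrite /= /ham_vec vec2_0 tofracN regvalK.
Qed.

Lemma ham1E w : (ham w 0 1)%:F = h%:F * w 0 0.
Proof.
have [r0 _ _] := form1log_coef w.
by rewrite /= /ham_vec vec2_1 regvalK.
Qed.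

Lemma form1logZE a w i : (a *: w : form1log h) 0 i = a%:F * w 0 i.
Proof. by rewrite mxE. Qed.

Lemma form1logDE v w i : (v + w) 0 i = v 0 i + w 0 i.
Proof. by rewrite mxE. Qed.

Lemma form1logBE v w i : (v - w) 0 i = v 0 i - w 0 i.
Proof. by rewrite !mxE. Qed.

Lemma form1log_eq v w : v 0 0 = w 0 0 -> v 0 1 = w 0 1 -> v = w.
Proof. by move=> e0 e1; apply: val_inj; apply: vec2P. Qed.

Lemma dlog0Ei (f : A) (i : 'I_2) : dlog0 h f 0 i = (f^`M(i))%:F.
Proof.
rewrite /= mxE; case: eqVneq => [->//|]; case: i => [[|[|//]]] // lti _.
by congr ((mderiv _ f)%:F); apply: val_inj.
Qed.

Lemma pilogZ a b v w : pilog (a *: v) (b *: w) = a * b * pilog v w.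
Proof.
apply/eqP; rewrite -tofrac_eq !tofracM !pilogE /ratpi !form1logZE.
by apply/eqP; ring.
Qed.

Lemma pilogC v w : pilog w v = - pilog v w.
Proof.
apply/eqP; rewrite -tofrac_eq tofracN !pilogE /ratpi.
by apply/eqP; ring.
Qed.

(** The exact parts of the two Lie derivatives are d pi(v, w) and d pi(w, v) = - d pi(v, w); their
    difference is twice d pi(v, w), and the last term of the bracket removes one copy. *)
Lemma koszulE v w :
  koszul v w =
  contract2 (ham v) (dlog1 w) - contract2 (ham w) (dlog1 v)
  + dlog0 h (pilog v w).
Proof.
rewrite /koszul /lie_derivative !contract1_ham (pilogC v w).
have -> : dlog0 h (- pilog v w) = - dlog0 h (pilog v w).
  by apply: form1log_eq; rewrite [RHS]mxE !dlog0Ei mderivN tofracN.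
by rewrite opprD opprK !addrA addrK addrAC.
Qed.

(** Contracting dx /\ dy with [ham v] gives - h v, so the contraction terms of the bracket are
    multiples of v and w themselves. *)
Lemma contract2_ham0E v w :
  contract2 (ham v) (dlog1 w) 0 0 = - (ratd1 w * (h%:F * v 0 0)).
Proof. by rewrite /= vec2_0 -ham1E. Qed.

Lemma contract2_ham1E v w :
  contract2 (ham v) (dlog1 w) 0 1 = - (ratd1 w * (h%:F * v 0 1)).
Proof. by rewrite /= vec2_1 -mulrN -ham0E. Qed.

Lemma der_hamE w f :
  (der (ham w) f)%:F =
  h%:F * (w 0 0 * (f^`M(1))%:F - w 0 1 * (f^`M(0))%:F).
Proof. by rewrite /der tofracD !tofracM ham0E ham1E; ring. Qed.

(** The terms in db are - a h (db /\ w) v + a pi(v, w) db. The relation (u /\ w) v + (w /\ v) u + (v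
    /\ u) w = 0 between three covectors of the plane turns them into a h (v /\ db) w, and h (v /\
    db) is [der (ham v) b]. The terms in da behave likewise. *)
Lemma koszulZ a b v w :
  koszul (a *: v) (b *: w) =
  (a * b) *: koszul v w + (a * der (ham v) b) *: w - (b * der (ham w) a) *: v.
Proof.
have pE i : (dlog0 h (pilog (a *: v) (b *: w))) 0 i =
    ((a^`M(i))%:F * b%:F + a%:F * (b^`M(i))%:F) * ratpi h v w
    + a%:F * b%:F * dlog0 h (pilog v w) 0 i.
  rewrite !dlog0Ei pilogZ !mderivM !(tofracD, tofracM) pilogE.
  by move: (ratpi _ _ _) => *; ring.
rewrite !koszulE; apply: form1log_eq;
  rewrite !(form1logBE, form1logDE, form1logZE, pE,
            contract2_ham0E, contract2_ham1E) !tofracM !der_hamE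
          !ratd1Z ?form1logZE /ratpi;
  move: (ratd1 _) (ratd1 _) (dlog0 _ _ _ _) => *; ring.
Qed.

Lemma koszul_closed v w : ratd1 v = 0 -> ratd1 w = 0 ->
  koszul v w = dlog0 h (pilog v w).
Proof.
move=> dv dw; rewrite koszulE; apply: form1log_eq;
  rewrite form1logDE form1logBE ?contract2_ham0E ?contract2_ham1E dv dw;
  by rewrite !(mul0r, oppr0, addr0, add0r).
Qed.

End LogarithmicKoszul.

(** * Scalar identities for the coefficients of the two generators *)

(* Abstract from {fraction {mpoly F[2]}}, where [field] is impractically slow. *)
Section FieldIdentities.
Context {L : fieldType}.
Implicit Types X Y H f g : L.
Hypothesis two_neq0 : 2 != 0 :> L.

Lemma double_mulf_half_div X {H} : H != 0 -> 2 * (H * (X / (2 * H))) = X.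
Proof. by move=> H0; field; rewrite two_neq0 H0. Qed.

Lemma double_mulf_half {X} : X != 0 -> 2 * (X * (1 / (2 * X))) = 1.
Proof. by move=> X0; field; rewrite two_neq0 X0. Qed.

(** Here X Y H stands for h. This and the next two identities evaluate h [omega1] /\ [omega2], then
    h [omega1] /\ df and h [omega2] /\ df for df = f dx + g dy. *)
Lemma omega_wedge {X Y H} : X != 0 -> Y != 0 -> H != 0 ->
  X * Y * H * (Y / (2 * (X * Y * H)) * (1 / (2 * Y))
    - X / (2 * (X * Y * H)) * - (1 / (2 * X))) = 2^-1.
Proof. by move=> X0 Y0 H0; field; rewrite two_neq0 X0 Y0 H0. Qed.

Lemma omega1_wedge {X Y H} f g : X != 0 -> Y != 0 -> H != 0 ->
  X * Y * H * (Y / (2 * (X * Y * H)) * g - X / (2 * (X * Y * H)) * f) =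
  2^-1 * (- X * f + Y * g).
Proof. by move=> X0 Y0 H0; field; rewrite two_neq0 X0 Y0 H0. Qed.

Lemma omega2_wedge {X Y} H f g : X != 0 -> Y != 0 ->
  X * Y * H * (- (1 / (2 * X)) * g - 1 / (2 * Y) * f) =
  - (2^-1 * (H * X * f + H * Y * g)).
Proof. by move=> X0 Y0; field; rewrite two_neq0 X0 Y0. Qed.

(* H = h with dh = G d(xy), P dX + Q dY is [omega1], and P1 = dP/dY, Q0 = dQ/dX. *)
Lemma closed_of_double {H G X Y P Q P1 Q0} : H != 0 ->
  2 * (H * P) = Y -> 2 * (H * Q) = X ->
  2 * (G * X * P + H * P1) = 1 -> 2 * (G * Y * Q + H * Q0) = 1 ->
  Q0 - P1 = 0.
Proof.
move=> H0 eP eQ eP1 eQ0.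
(* After multiplication by 2 H^2, the terms in G become G X Y and G Y X, which cancel. *)
apply: (mulfI H0); apply: (mulfI H0); apply: (mulfI two_neq0).
transitivity (H * (2 * (G * Y * Q + H * Q0)) - H * (2 * (G * X * P + H * P1))
  + G * X * (2 * (H * P)) - G * Y * (2 * (H * Q))); first by ring.
by rewrite eP eQ eP1 eQ0; ring.
Qed.

End FieldIdentities.

(** * The generators for h = xy h_t(xy): closedness, pairing and anchors *)

Section Arrangement.
Context {F : fieldType} {n : nat} {alpha : nat -> F}.
Hypothesis two_neq0 : 2 != 0 :> F.
Hypothesis alpha_neq0 : alpha 1%N * alpha n != 0.
Hypothesis ht_sep : coprimep (ht n alpha) (ht n alpha)^`().
Local Notation A := {mpoly F[2]}.
Local Notation K := {fraction A}.
Local Notation x := ('X_(0 : 'I_2) : A).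
Local Notation y := ('X_(1 : 'I_2) : A).
Local Notation omega1 := (omega1 alpha_neq0 ht_sep).
Local Notation omega2 := (omega2 alpha_neq0 ht_sep).

Let two_fracF : 2 != 0 :> K.
Proof. by rewrite two_subproof tofrac_eq0 mpolyC_eq0. Qed.

Let x_fracF : x%:F != 0.
Proof. by rewrite tofrac_eq0 mpolyXU_neq0. Qed.

Let y_fracF : y%:F != 0.
Proof. by rewrite tofrac_eq0 mpolyXU_neq0. Qed.

Let hxy_fracF : (hxy n alpha)%:F != 0.
Proof. by rewrite tofrac_eq0 (hxy_neq0 alpha_neq0). Qed.

Let hdiv_fracE : (hdiv n alpha)%:F = x%:F * y%:F * (hxy n alpha)%:F.
Proof. by rewrite /hdiv -!tofracM. Qed.

Lemma mderiv_subst_xy (i : 'I_2) (p : {poly F}) :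
  (subst_xy p)^`M(i) = subst_xy p^`() * (x * y)^`M(i).
Proof.
(* A partial derivative is the derivation along a unit row, which reduces the claim to
   [der_subst_xy]. *)
have E (f : A) : f^`M(i) = der (\row_j (i == j)%:R) f.
  rewrite /der !mxE; case: i => [[|[|//]]] lti /=; rewrite mul1r mul0r ?(addr0, add0r).
    by congr (mderiv _ f); apply: val_inj.
  by congr (mderiv _ f); apply: val_inj.
by rewrite !E der_subst_xy.
Qed.

Lemma fracder_double (i : 'I_2) (u : K) : fracder i (2 * u) = 2 * fracder i u.
Proof. by rewrite !mulr_natl !mulr2n fracderD. Qed.

Lemma fracder_hdiv (i : 'I_2) : fracder i (hdiv n alpha)%:F =
  (subst_xy ('X * ht n alpha)^`())%:F * ((x * y)^`M(i))%:F.
Proof. by rewrite fracderF hdivE mderiv_subst_xy tofracM. Qed.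

(** Since h is a polynomial in xy, dh is a multiple of d(xy), whence d(1/h) /\ d(xy) = 0. *)
Lemma omega1_closed : ratd1 omega1 = 0.
Proof.
have HF : (hdiv n alpha)%:F != 0.
  rewrite hdiv_fracE; apply: mulf_neq0 (hxy_fracF).
  exact: mulf_neq0 x_fracF y_fracF.
have eP := double_mulf_half_div two_fracF y%:F HF.
have eQ := double_mulf_half_div two_fracF x%:F HF.
rewrite /= /ratd1 /omega1_vec vec2_0 vec2_1.
(* The coefficients are kept only through 2 h P = y and 2 h Q = x; differentiating these products
   avoids the quotient rule. *)
move: (y%:F / _) (x%:F / _) eP eQ => P Q eP eQ.
have := congr1 (fracder 1) eP; have := congr1 (fracder 0) eQ.
rewrite !fracder_double !fracderM !fracder_hdiv !fracderF !mderivM !mderivXU /=.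
rewrite !mul0r !mul1r !mulr0 !mulr1 addr0 add0r tofrac1 => eQ0 eP1.
exact: (closed_of_double two_fracF HF eP eQ eP1 eQ0).
Qed.

(** Each coefficient depends only on the variable of its own differential, so both cross derivatives
    vanish. *)
Lemma omega2_closed : ratd1 omega2 = 0.
Proof.
have V (i j : 'I_2) : i != j -> fracder i (1 / (2 * ('X_j : A)%:F)) = 0 :> K.
  move=> /negPf ij; have jF : ('X_j : A)%:F != 0 by rewrite tofrac_eq0 mpolyXU_neq0.
  have := congr1 (fracder i) (double_mulf_half two_fracF jF).
  rewrite fracder_double fracderM fracderF mderivXU ij tofrac0 mul0r add0r.
  rewrite -[X in _ = fracder i X]tofrac1 fracderF -mpolyC1 mderivC tofrac0.
  by move/eqP; rewrite mulf_eq0 (negPf two_fracF) mulf_eq0 (negPf jF) => /eqP.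
have N i (u : K) : fracder i (- u) = - fracder i u.
  apply/eqP; rewrite -addr_eq0 -fracderD addNr -tofrac0 fracderF.
  by rewrite mderiv0.
by rewrite /= /ratd1 /omega2_vec vec2_0 vec2_1 N !V // oppr0 subr0.
Qed.

Lemma ratpi_omega : ratpi (hdiv n alpha) omega1 omega2 = 2^-1.
Proof.
rewrite /ratpi /= /omega1_vec /omega2_vec !vec2_0 !vec2_1 hdiv_fracE.
exact (omega_wedge two_fracF x_fracF y_fracF hxy_fracF).
Qed.

Lemma der_ham_omega1 f :
  der (ham omega1) f = 2^-1 *: der (delta2 n alpha) f.
Proof.
apply/eqP; rewrite -tofrac_eq der_hamE -mul_mpolyC [X in _ == X]tofracM half_subproof.
rewrite /der /= /delta2_vec /omega1_vec !vec2_0 !vec2_1.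
by rewrite hdiv_fracE tofracD !tofracM tofracN (omega1_wedge two_fracF _ _ x_fracF y_fracF hxy_fracF).
Qed.

Lemma der_ham_omega2 f :
  der (ham omega2) f = - (2^-1 *: der (delta1 n alpha) f).
Proof.
apply/eqP; rewrite -tofrac_eq der_hamE tofracN -mul_mpolyC.
rewrite [X in _ == - X]tofracM half_subproof.
rewrite /der /= /delta1_vec /omega2_vec !mxE /=.
by rewrite hdiv_fracE tofracD !tofracM (omega2_wedge two_fracF _ _ _ x_fracF y_fracF).
Qed.

Lemma koszul_omega : koszul omega1 omega2 = 0.
Proof.
rewrite (koszul_closed _ _ omega1_closed omega2_closed).
have -> : pilog omega1 omega2 = (2^-1)%:MP.
  by apply/eqP; rewrite -tofrac_eq pilogE ratpi_omega half_subproof.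
by apply: form1log_eq; rewrite dlog0Ei mderivC tofrac0 mxE.
Qed.

End Arrangement.


Theorem proposition4p10 (R : realType) (n : nat) (n_gt0 : (0 < n)%N)
    (alpha : nat -> R[i])
    (alpha_neq0 : alpha 1%N * alpha n != 0)
    (ht_sep : coprimep (ht n alpha) (ht n alpha)^`())
    (a b : {mpoly R[i][2]}) :
  koszul (a *: omega1 alpha_neq0 ht_sep) (b *: omega2 alpha_neq0 ht_sep) =
    (2^-1 *: a * der (delta2 n alpha) b) *: omega2 alpha_neq0 ht_sep +
    (2^-1 *: b * der (delta1 n alpha) a) *: omega1 alpha_neq0 ht_sep.
Proof.
have two_neq0 : 2 != 0 :> R[i] by rewrite Num.Theory.pnatr_eq0.
rewrite koszulZ koszul_omega // scaler0 add0r.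
(* The sign in the anchor of [omega2] cancels the sign of the second anchor term in [koszulZ]. *)
rewrite der_ham_omega1 // der_ham_omega2 // -scaleNr mulrN opprK.
by rewrite -!scalerAr -!scalerAl.
Qed.
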